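(* Suppose a group $G$ acts faithfully and uniformly equicontinuously on a metrizable uniform space $X$. Then the following are equivalent. 1. The action has small scale bounded orbits and the projection $p:X\to X/G$ has complete fibers. 2. There is a Mittag-Leffler inverse sequence of groups $\{G_i,\psi_i\}$ with trivial $\varprojlim^1$, an inverse sequence of uniform spaces $\{X_i,\phi_i\}$, and compatible actions of $G_i$ on $X_i$ that are uniformly properly discontinuous and neutral, with $G$ isomorphic to $\varprojlim G_i$, $X$ uniformly equivalent to $\varprojlim X_i$, and the action of $G$ on $X$ equivalent to the induced action of $\varprojlim G_i$ on $\varprojlim X_i$; that is, there are a group isomorphism $\theta:G\to\varprojlim G_i$ and a uniform equivalence $\Phi:X\to\varprojlim X_i$ with $\Phi(gx)=\theta(g)\Phi(x)$ for all $g\in G$, $x\in X$.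
   Context: Let a group $G$ act on a uniform space $X$. - The action is uniformly equicontinuous if for each entourage $E$ of $X$ there is an entourage $F$ of $X$ such that for every $g\in G$, $F\subset g^{-1}(E)$, i.e. $(gx,gy)\in E$ whenever $(x,y)\in F$. - The action is neutral if for each entourage $E$ there is an entourage $F$ such that whenever $(x,gy)\in F$ (with $x,y\in X$, $g\in G$) there is $h\in G$ with $(hx,y)\in E$. - The action is uniformly properly discontinuous if there is an entourage $E_0$ such that if $(x,gx)\in E_0$ for some $x\in X$ then $g=1$. - For an entourage $E$, $G_E$ is the subgroup of $G$ generated by $\{g\in G:(x,gx)\in E\text{ for some }x\in X\}$. The action has small scale bounded orbits if for each entourage $E$ there is an entourage $F$ such that the orbits of $G_F$ on $X$ are $E$-bounded (a set $A$ is $E$-bounded if $A\times A\subset E$). The projection $p:X\to X/G$ is the quotient map to the orbit space; it has complete fibers if each fiber $p^{-1}(z)$ (i.e. each orbit) is complete in the subspace uniform structure of $X$. A uniform space is metrizable if its uniform structure is induced by a metric. An inverse sequence $\{G_i,\psi_i\}_{i\ge1}$ of groups has homomorphisms $\psi_{i+1}:G_{i+1}\to G_i$; an inverse sequence $\{X_i,\phi_i\}_{i\ge 1}$ of uniform spaces has uniformly continuous maps $\phi_{i+1}:X_{i+1}\to X_i$. $\varprojlim X_i$ carries the inverse limit uniform structure. The sequence of groups is Mittag-Leffler if for each $n$ there is $m\ge n$ such that for all $k\ge m$ the images of $G_k$ and $G_m$ in $G_n$ coincide. It has trivial $\varprojlim^1$ if the function $\prod G_i\to\prod G_i$, $(g_i)\mapsto(g_i\psi_{i+1}(g_{i+1})^{-1})$,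 is surjective. Actions of $G_i$ on $X_i$ are compatible if $\phi_{i+1}(gx)=\psi_{i+1}(g)\phi_{i+1}(x)$; the induced action of $\varprojlim G_i$ on $\varprojlim X_i$ is $(g_i)(x_i)=(g_ix_i)$. A uniform equivalence is a bijection that is uniformly continuous in both directions. *)

(* Defs.v *)
From HB Require Import structures.
From mathcomp Require Import all_boot all_order all_algebra.
From mathcomp Require Import all_classical all_reals topology.

Set Implicit Arguments.
Unset Strict Implicit.
Unset Printing Implicit Defensive.

Local Open Scope classical_set_scope.
Local Open Scope group_scope.

(* The library has actions of finite groups only. No continuity is built in. *)
Record group_action (G : groupType) (X : Type) := GroupAction {
  act :> G -> X -> X;
  act1 : forall x, act 1 x = x;
  actM : forall g h x, act (g * h) x = act g (act h x) }.

Definition faithful (G : groupType) (X : Type) (a : group_action G X) :=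
  forall g, (forall x, a g x = x) -> g = 1.

Definition orbit_of (G : groupType) (X : Type) (a : group_action G X) (x : X) :
  set X := range (a^~ x).

Definition orbit_space (G : groupType) (X : Type) (a : group_action G X) :=
  set_type (range (orbit_of a)).

Definition orbit_proj (G : groupType) (X : Type) (a : group_action G X)
    (x : X) : orbit_space a :=
  SigSub (mem_set (imageT (orbit_of a) x)).

Definition is_subgroup (G : groupType) (H : set G) :=
  H 1 /\ forall g h, H g -> H h -> H (g * h^-1).

Section uniform_actions.
Context (G : groupType) (X : uniformType) (a : group_action G X).

Definition uniformly_equicontinuous :=
  forall E : set (X * X), entourage E ->
  exists2 F : set (X * X), entourage F &
    forall g, F `<=` [set xy | E (a g xy.1, a g xy.2)].

Definition neutral :=
  forall E : set (X * X), entourage E ->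
  exists2 F : set (X * X), entourage F &
    forall x y g, F (x, a g y) -> exists h, E (a h x, y).

Definition uniformly_properly_discontinuous :=
  exists2 E0 : set (X * X), entourage E0 &
    forall g, (exists x, E0 (x, a g x)) -> g = 1.

Definition scale_subgroup (E : set (X * X)) : set G :=
  smallest (@is_subgroup G) [set g | exists x, E (x, a g x)].

Definition bounded_by (E : set (X * X)) (A : set X) := A `*` A `<=` E.

Definition small_scale_bounded_orbits :=
  forall E : set (X * X), entourage E ->
  exists2 F : set (X * X), entourage F &
    forall x, bounded_by E [set a g x | g in scale_subgroup F].

End uniform_actions.

(* [completeType] also requires a point, so completeness is restated for
   arbitrary uniform spaces. *)
Definition complete_space (X : uniformType) :=
  forall F : set_system X, ProperFilter F -> cauchy F -> exists x : X, F --> x.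

(* Fibers carry the library's subspace uniformity on [set_type]. *)
Definition complete_fibers (X : uniformType) (Z : Type) (p : X -> Z) :=
  forall z : Z, complete_space (set_type (p @^-1` [set z])).

Definition metrizable (R : realType) (X : uniformType) :=
  exists d : X -> X -> R,
    [/\ forall x y, d x y = 0%R <-> x = y,
        forall x y, d x y = d y x,
        forall x y z, (d x z <= d x y + d y z)%R &
        @entourage X = entourage_ (fun x e => [set y | (d x y < e)%R])].

Definition uniform_equivalence (X Y : uniformType) (f : X -> Y) :=
  exists f' : Y -> X, [/\ cancel f f', cancel f' f,
    unif_continuous f & unif_continuous f'].

(* Inverse sequences are indexed from 0: the bonding map f i goes from T i.+1
   to T i. *)
Definition threads (T : nat -> Type) (f : forall i, T i.+1 -> T i) :
  set (forall i, T i) := [set x | forall i, f i (x i.+1) = x i].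

(* The composite T (k + n) -> T n of k consecutive bonding maps. *)
Fixpoint bond (T : nat -> Type) (f : forall i, T i.+1 -> T i) (n k : nat) :
    T (k + n) -> T n :=
  if k is k'.+1 return T (k + n) -> T n
  then fun x => bond f (f (k' + n) x) else id.
Arguments bond {T} f n k.

Section group_sequences.
Context (G : nat -> groupType) (psi : forall i, UMagmaMorphism.type (G i.+1) (G i)).

Definition invlim_group := set_type (threads (fun i => psi i)).

(* With m = n + p and k = n + q, this compares the images of G_m and G_k in
   G_n. *)
Definition mittag_leffler :=
  forall n, exists p, forall q, p <= q ->
    range (bond (fun i => psi i) n q) = range (bond (fun i => psi i) n p).

Definition lim1_map (g : forall i, G i) : forall i, G i :=
  fun i => g i * (psi i (g i.+1))^-1.

Definition trivial_lim1 := forall h, exists g, lim1_map g = h.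

HB.instance Definition _ := Choice.on invlim_group.

Lemma invlim_one_subproof : threads (fun i => psi i) (fun=> 1).
Proof. by move=> i; rewrite gmulf1. Qed.

Lemma invlim_mul_subproof (g h : invlim_group) :
  threads (fun i => psi i) (fun i => val g i * val h i).
Proof. by move=> i; rewrite gmulfM (set_valP g) (set_valP h). Qed.

Lemma invlim_inv_subproof (g : invlim_group) :
  threads (fun i => psi i) (fun i => (val g i)^-1).
Proof. by move=> i; rewrite gmulfV (set_valP g). Qed.

Definition invlim_one : invlim_group := SigSub (mem_set invlim_one_subproof).
Definition invlim_mul (g h : invlim_group) : invlim_group :=
  SigSub (mem_set (invlim_mul_subproof g h)).
Definition invlim_inv (g : invlim_group) : invlim_group :=
  SigSub (mem_set (invlim_inv_subproof g)).

Lemma invlim_mulA : associative invlim_mul.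
Proof.
by move=> x y z; apply/val_inj/functional_extensionality_dep => i /=;
  rewrite mulgA.
Qed.
Lemma invlim_1mul : left_id invlim_one invlim_mul.
Proof.
by move=> x; apply/val_inj/functional_extensionality_dep => i /=; rewrite mul1g.
Qed.
Lemma invlim_mul1 : right_id invlim_one invlim_mul.
Proof.
by move=> x; apply/val_inj/functional_extensionality_dep => i /=; rewrite mulg1.
Qed.
Lemma invlim_Vmul : left_inverse invlim_one invlim_inv invlim_mul.
Proof.
by move=> x; apply/val_inj/functional_extensionality_dep => i /=; rewrite mulVg.
Qed.
Lemma invlim_mulV : right_inverse invlim_one invlim_inv invlim_mul.
Proof.
by move=> x; apply/val_inj/functional_extensionality_dep => i /=; rewrite mulgV.
Qed.

HB.instance Definition _ := isGroup.Build invlim_group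
  invlim_mulA invlim_1mul invlim_mul1 invlim_Vmul invlim_mulV.

End group_sequences.

(* The uniformity is the one induced from the product of the X i. *)
Definition invlim_space (X : nat -> uniformType)
    (phi : forall i, X i.+1 -> X i) : uniformType :=
  set_type (threads phi : set (prod_topology X)).

Section compatible_actions.
Context (G : nat -> groupType) (psi : forall i, UMagmaMorphism.type (G i.+1) (G i)).
Context (X : nat -> uniformType) (phi : forall i, X i.+1 -> X i).
Context (a : forall i, group_action (G i) (X i)).

Definition compatible_actions :=
  forall i (g : G i.+1) (x : X i.+1),
    @phi i (a i.+1 g x) = a i (psi i g) (@phi i x).

Context (compat : compatible_actions).

Lemma invlim_act_subproof (g : invlim_group psi) (x : invlim_space phi) :
  threads phi (fun i => a i (val g i) (val x i)).
Proof. by move=> i; rewrite compat (set_valP g) (set_valP x). Qed.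

Definition invlim_act (g : invlim_group psi) (x : invlim_space phi) :
  invlim_space phi := SigSub (mem_set (invlim_act_subproof g x)).

Lemma invlim_act1 x : invlim_act 1 x = x.
Proof.
by apply/val_inj/functional_extensionality_dep => i /=; rewrite act1.
Qed.

Lemma invlim_actM g h x :
  invlim_act (g * h) x = invlim_act g (invlim_act h x).
Proof.
by apply/val_inj/functional_extensionality_dep => i /=; rewrite actM.
Qed.

Definition invlim_action : group_action (invlim_group psi) (invlim_space phi) :=
  GroupAction invlim_act1 invlim_actM.

End compatible_actions.

(* Main.v *)
Require Import Defs.
From HB Require Import structures.
From mathcomp Require Import all_boot all_order all_algebra.
From mathcomp Require Import all_classical all_reals topology.

(* From (2) to (1): an element of G moving some point less than the
   discontinuity scale of G_n on X_n acts trivially on X_n, which bounds the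
   orbits of the scale subgroups; and a Cauchy filter on an orbit G x determines
   the n-th coordinate of g for the points g x far along the filter, hence a
   thread of the G_n, which is the image of some g with g x its limit.

   From (1) to (2): choose a decreasing base E_n of invariant entourages such
   that the orbits of the normal subgroups N_n = G_{E_n} shrink, and take
   G_n = G/N_n acting on X_n = X/N_n. The bonding maps of the groups are
   surjective, which gives Mittag-Leffler and trivial lim^1. A thread of the G_n
   or of the X_n lifts to a Cauchy sequence in a single orbit; its limit, given
   by completeness of the fibers, represents the thread. *)

Set Implicit Arguments.
Unset Strict Implicit.
Unset Printing Implicit Defensive.

Local Open Scope classical_set_scope.
Local Open Scope group_scope.
Local Open Scope quotient_scope.

(** * Normal subgroups and quotient groups *)

Record normal_subgroup (G : groupType) := NormalSubgroup {
  carrier :> G -> Prop;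
  normal_is_subgroup : is_subgroup carrier;
  normal_conj : forall g h, carrier g -> carrier (h * g * h^-1) }.

Section subgroup_theory.
Context (G : groupType) (H : set G) (subH : is_subgroup H).

Lemma subgroup1 : H 1. Proof. exact: subH.1. Qed.

Lemma subgroupV g : H g -> H g^-1.
Proof.
by move=> Hg; rewrite -[g^-1]mul1g; apply: subH.2 => //; exact: subH.1.
Qed.

Lemma subgroupM g h : H g -> H h -> H (g * h).
Proof.
by move=> Hg Hh; rewrite -[h]invgK; apply: subH.2 => //; exact: subgroupV.
Qed.

End subgroup_theory.

Section quotient_group.
Context (G : groupType) (N : normal_subgroup G).
Let subN : is_subgroup N := normal_is_subgroup N.

Definition coset_rel (g h : G) : bool := `[< N (g * h^-1) >].

Lemma coset_rel_refl : reflexive coset_rel.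
Proof. by move=> g; apply/asboolP; rewrite mulgV; exact: subgroup1. Qed.

Lemma coset_rel_sym : symmetric coset_rel.
Proof.
move=> g h; apply/asboolP/asboolP => /(subgroupV subN);
  by rewrite invgM invgK.
Qed.

Lemma coset_rel_trans : transitive coset_rel.
Proof.
move=> g h k /asboolP Nhg /asboolP Ngk; apply/asboolP.
by have := subgroupM subN Nhg Ngk; rewrite mulgA mulgVK.
Qed.

Definition coset_equiv :=
  EquivRel coset_rel coset_rel_refl coset_rel_sym coset_rel_trans.

Definition quotient_group := {eq_quot coset_equiv}.
HB.instance Definition _ := EqQuotient.on quotient_group.
HB.instance Definition _ := Choice.on quotient_group.

Definition coset (g : G) : quotient_group := \pi_quotient_group g.

Lemma coset_eq g h : coset g = coset h <-> N (g * h^-1).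
Proof.
split=> [/eqmodP/asboolP//|Ngh]; exact/eqmodP/asboolP.
Qed.

Lemma coset_repr (q : quotient_group) : coset (repr q) = q.
Proof. exact: reprK. Qed.

Definition quotient_mul (q r : quotient_group) := coset (repr q * repr r).
Definition quotient_inv (q : quotient_group) := coset (repr q)^-1.

Lemma quotient_mul_coset g h : quotient_mul (coset g) (coset h) = coset (g * h).
Proof.
apply/coset_eq.
have /coset_eq Ng := coset_repr (coset g).
have /coset_eq Nh := coset_repr (coset h).
(* For representatives [n * g] and [m * h] with [n], [m] in [N], the product is
   [n * (g * m * g^-1) * (g * h)]; normality puts the middle factor in [N]. *)
have := subgroupM subN Ng (normal_conj g Nh).
by rewrite invgM !mulgA mulgVK.
Qed.

Lemma quotient_inv_coset g : quotient_inv (coset g) = coset g^-1.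
Proof.
apply/esym/coset_eq; have /coset_eq Ng := coset_repr (coset g).
have := normal_conj g^-1 Ng.
by rewrite !invgK mulgA mulgVK.
Qed.

Lemma quotient_mulA : associative quotient_mul.
Proof.
move=> q r s; rewrite -(coset_repr q) -(coset_repr r) -(coset_repr s).
by rewrite !quotient_mul_coset mulgA.
Qed.

Lemma quotient_1mul : left_id (coset 1) quotient_mul.
Proof. by move=> q; rewrite -(coset_repr q) quotient_mul_coset mul1g. Qed.

Lemma quotient_mul1 : right_id (coset 1) quotient_mul.
Proof. by move=> q; rewrite -(coset_repr q) quotient_mul_coset mulg1. Qed.

Lemma quotient_Vmul : left_inverse (coset 1) quotient_inv quotient_mul.
Proof.
move=> q; rewrite -(coset_repr q) quotient_inv_coset quotient_mul_coset.
by rewrite mulVg.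
Qed.

Lemma quotient_mulV : right_inverse (coset 1) quotient_inv quotient_mul.
Proof.
move=> q; rewrite -(coset_repr q) quotient_inv_coset quotient_mul_coset.
by rewrite mulgV.
Qed.

HB.instance Definition _ := isGroup.Build quotient_group
  quotient_mulA quotient_1mul quotient_mul1 quotient_Vmul quotient_mulV.

Lemma cosetM g h : coset (g * h) = coset g * coset h.
Proof. by rewrite -quotient_mul_coset. Qed.

Lemma cosetV g : coset g^-1 = (coset g)^-1.
Proof. by rewrite -quotient_inv_coset. Qed.

Lemma coset1P g : coset g = 1 <-> N g.
Proof. by rewrite (coset_eq g 1) invg1 mulg1. Qed.

End quotient_group.

Section coarser_quotient_group.
Context (G : groupType) (M N : normal_subgroup G) (MN : M `<=` N).

Definition coset_coarsen (q : quotient_group M) : quotient_group N :=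
  coset N (repr q).

Lemma coset_coarsenE g : coset_coarsen (coset M g) = coset N g.
Proof. by apply/coset_eq/MN/coset_eq/coset_repr. Qed.

Lemma coset_coarsen_morph : monoid_morphism coset_coarsen.
Proof.
split=> [|q r]; first exact: coset_coarsenE.
rewrite -(coset_repr q) -(coset_repr r) -cosetM !coset_coarsenE.
by rewrite cosetM.
Qed.

HB.instance Definition _ := isUMagmaMorphism.Build
  (quotient_group M) (quotient_group N) coset_coarsen coset_coarsen_morph.

Definition coset_coarsening :
  UMagmaMorphism.type (quotient_group M) (quotient_group N) := coset_coarsen.

End coarser_quotient_group.

(** * Quotients of a uniform space by a normal subgroup *)

Section action_theory.
Context (G : groupType) (X : Type) (a : group_action G X).

Lemma actK g : cancel (a g) (a g^-1).
Proof. by move=> x; rewrite -actM mulVg act1. Qed.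

End action_theory.

Section quotient_space.
Context (G : groupType) (X : uniformType) (a : group_action G X).
Context (equicont : uniformly_equicontinuous a) (N : normal_subgroup G).
Let subN : is_subgroup N := normal_is_subgroup N.

Definition orbit_rel (x y : X) : bool := `[< exists2 n, N n & a n x = y >].

Lemma orbit_rel_refl : reflexive orbit_rel.
Proof.
by move=> x; apply/asboolP; exists 1; [exact: subgroup1|rewrite act1].
Qed.

Lemma orbit_rel_sym : symmetric orbit_rel.
Proof.
by move=> x y; apply/asboolP/asboolP => -[n Nn <-]; exists n^-1;
  rewrite ?actK//; exact: subgroupV.
Qed.

Lemma orbit_rel_trans : transitive orbit_rel.
Proof.
move=> y x z /asboolP[n Nn <-] /asboolP[m Nm <-]; apply/asboolP.
by exists (m * n); [exact: subgroupM|rewrite actM].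
Qed.

Definition orbit_equiv :=
  EquivRel orbit_rel orbit_rel_refl orbit_rel_sym orbit_rel_trans.

(* Equicontinuity is what makes the images of entourages a uniformity, hence
   its presence among the parameters of the type. *)
Definition quotient_space of uniformly_equicontinuous a := {eq_quot orbit_equiv}.
Local Notation Q := (quotient_space equicont).
HB.instance Definition _ := EqQuotient.on Q.
HB.instance Definition _ := Choice.on Q.

Definition orbit_class (x : X) : Q := \pi_Q x.

Lemma orbit_eq x y :
  orbit_class x = orbit_class y <-> exists2 n, N n & a n x = y.
Proof. by split=> [/eqmodP/asboolP//|xy]; exact/eqmodP/asboolP. Qed.

Lemma orbit_repr (q : Q) : orbit_class (repr q) = q.
Proof. exact: reprK. Qed.

Definition map_orbit (xy : X * X) : Q * Q :=
  (orbit_class xy.1, orbit_class xy.2).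

Definition quotient_entourage : set_system (Q * Q) :=
  filter_from entourage (fun E => map_orbit @` E).

Lemma quotient_entourage_filter : Filter quotient_entourage.
Proof.
apply: filter_from_filter; first by exists setT; exact: filterT.
move=> A B entA entB; exists (A `&` B); first exact: filterI.
by move=> _ [xy [Axy Bxy] <-]; split; exists xy.
Qed.

Lemma quotient_entourage_refl A : quotient_entourage A -> diagonal `<=` A.
Proof.
move=> [E entE EA] [q r]/diagonalP ->; apply: EA.
by exists (repr r, repr r); rewrite /map_orbit/= ?orbit_repr//; exact: entourage_refl.
Qed.

Lemma quotient_entourage_inv A :
  quotient_entourage A -> quotient_entourage A^-1%relation.
Proof.
move=> [E entE EA]; exists E^-1%relation; first exact: entourage_inv.
by move=> _ [[x y] Exy <-]; apply: EA; exists (y, x).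
Qed.

(** Middle points of two pairs over the same middle orbit differ by some [n] in [N]. Moving the
    first pair by [n] makes the pairs composable, and equicontinuity bounds the moved pair
    independently of [n]. *)
Lemma quotient_entourage_split A : quotient_entourage A ->
  exists2 B, quotient_entourage B & (B \; B `<=` A)%relation.
Proof.
move=> [E entE EA]; have [F entF FE] := equicont (entourage_split_ent entE).
exists (map_orbit @` (F `&` split_ent E)).
  by exists (F `&` split_ent E) => //; apply: filterI.
move=> [q s] /= [r [[x y] [/= Fxy _] [<- <-]]] [[y' z] [_ Eyz] [/= yy' <-]].
apply: EA; have /orbit_eq[n Nn ny] := esym yy'.
exists (a n x, z).
  by apply: (entourage_split y') => //; rewrite -ny; exact: FE Fxy.
by congr pair => /=; apply/esym/orbit_eq; exists n.
Qed.

HB.instance Definition _ := isUniform.Build Q quotient_entourage_filter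
  quotient_entourage_refl quotient_entourage_inv quotient_entourage_split.

Lemma entourage_orbit E : entourage E -> @entourage Q (map_orbit @` E).
Proof. by move=> entE; exists E. Qed.

Lemma orbit_unif_continuous : unif_continuous (orbit_class : X -> Q).
Proof.
by move=> A [E entE EA]; apply: filterS entE => xy Exy; apply: EA; exists xy.
Qed.

Definition quotient_act (q : quotient_group N) (r : Q) : Q :=
  orbit_class (a (repr q) (repr r)).

Lemma quotient_actE g x :
  quotient_act (coset N g) (orbit_class x) = orbit_class (a g x).
Proof.
apply/esym/orbit_eq.
have /coset_eq Ng := coset_repr (coset N g).
have /esym/orbit_eq[n Nn <-] := orbit_repr (orbit_class x).
(* This element carries [a g x] to [a (repr (coset N g)) (a n x)], and is grouped as a product of
   two elements of [N]. *)
exists (repr (coset N g) * g^-1 * (g * n * g^-1)).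
  by apply: subgroupM => //; exact: normal_conj.
by rewrite -!actM !mulgA !mulgVK.
Qed.

Lemma quotient_act1 q : quotient_act 1 q = q.
Proof. by rewrite -(orbit_repr q) (quotient_actE 1) act1. Qed.

Lemma quotient_actM g h q :
  quotient_act (g * h) q = quotient_act g (quotient_act h q).
Proof.
rewrite -(orbit_repr q) -(coset_repr g) -(coset_repr h) -cosetM !quotient_actE.
by rewrite actM.
Qed.

Definition quotient_action : group_action (quotient_group N) Q :=
  GroupAction quotient_act1 quotient_actM.

Lemma quotient_actionE g x :
  quotient_action (coset N g) (orbit_class x) = orbit_class (a g x).
Proof. exact: quotient_actE. Qed.

(** A close pair over [x] and [g y] is moved by a lift of [g^-1] to a close pair over [g^-1 x] and
    [y], so [h = g^-1] works. *)
Lemma quotient_action_neutral : neutral quotient_action.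
Proof.
move=> A [E entE EA]; have [F entF FE] := equicont entE.
exists (map_orbit @` F); first exact: entourage_orbit.
move=> x y g [[u v] Fuv [ux vgy]]; exists g^-1; apply: EA.
exists (a (repr g)^-1 u, a (repr g)^-1 v); first exact: FE Fuv.
rewrite /map_orbit/= -!quotient_actionE cosetV coset_repr.
by rewrite ux vgy actK.
Qed.

(** If a class and its translate by [g] have representatives related by [E], then these are [x] and
    [n * repr g] applied to [x] for some [n] in [N]; hence [n * repr g], and with it [repr g], lies
    in [N]. *)
Lemma quotient_action_upd E : entourage E ->
  (forall g x, E (x, a g x) -> N g) ->
  uniformly_properly_discontinuous quotient_action.
Proof.
move=> entE EN; exists (map_orbit @` E); first exact: entourage_orbit.
move=> g [q [[x y] Exy [xq yq]]]; rewrite -(coset_repr g) -xq /= in yq *.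
move: yq; rewrite quotient_actE => /esym/orbit_eq[n Nn ngx].
apply/coset1P; have /(subgroupM subN (subgroupV subN Nn)) : N (n * repr g).
  by apply: (EN _ x); rewrite actM ngx.
by rewrite mulKg.
Qed.

End quotient_space.

Section coarser_quotient_space.
Context (G : groupType) (X : uniformType) (a : group_action G X).
Context (equicont : uniformly_equicontinuous a).
Context (M N : normal_subgroup G) (MN : M `<=` N).

Definition orbit_coarsen (q : quotient_space M equicont) :
  quotient_space N equicont := orbit_class equicont N (repr q).

Lemma orbit_coarsenE x :
  orbit_coarsen (orbit_class equicont M x) = orbit_class equicont N x.
Proof.
have /orbit_eq[m /MN Nm mx] := orbit_repr (orbit_class equicont M x).
by apply/orbit_eq; exists m.
Qed.

Lemma orbit_coarsen_unif_continuous : unif_continuous orbit_coarsen.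
Proof.
move=> A [E entE EA]; exists E => // _ [[x y] Exy <-]; apply: EA.
by exists (x, y) => //; rewrite /map_orbit/= !orbit_coarsenE.
Qed.

Lemma coarsen_compatible (q : quotient_group M)
    (x : quotient_space M equicont) :
  orbit_coarsen (quotient_action equicont M q x) =
  quotient_action equicont N (coset_coarsening MN q) (orbit_coarsen x).
Proof.
rewrite -(coset_repr q) -(orbit_repr x) quotient_actionE !orbit_coarsenE.
by rewrite [coset_coarsening _ _]coset_coarsenE// quotient_actionE.
Qed.

End coarser_quotient_space.

(** * Invariant entourages and scale subgroups *)

Section scale_subgroup_theory.
Context (G : groupType) (X : uniformType) (a : group_action G X).

Definition act_invariant (E : set (X * X)) :=
  forall g x y, E (x, y) -> E (a g x, a g y).

(** The intersection of all translates of [E] is invariant, and equicontinuity makes it an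
    entourage. *)
Lemma invariant_entourage E : uniformly_equicontinuous a -> entourage E ->
  exists F, [/\ entourage F, act_invariant F & F `<=` E].
Proof.
move=> equicont entE; have [F entF FE] := equicont _ entE.
exists [set xy | forall g, E (a g xy.1, a g xy.2)]; split.
- by apply: filterS entF => xy Fxy g; exact: FE Fxy.
- by move=> g x y Exy h /=; rewrite -!actM.
- by move=> [x y] /(_ 1)/=; rewrite !act1.
Qed.

Lemma scale_subgroup_is_subgroup E : is_subgroup (scale_subgroup a E).
Proof.
split=> [A [[]]//|g h Ng Nh A AE].
by apply: AE.1.2; [exact: Ng|exact: Nh].
Qed.

Lemma scale_subgroup_gen E g x : E (x, a g x) -> scale_subgroup a E g.
Proof. by move=> Exgx; apply: sub_gen_smallest; exists x. Qed.

Lemma scale_subgroup_sub E (H : set G) : is_subgroup H ->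
  (forall g x, E (x, a g x) -> H g) -> scale_subgroup a E `<=` H.
Proof. by move=> subH EH; apply: smallest_sub => // g [x /EH]. Qed.

Lemma scale_subgroupS E F : E `<=` F ->
  scale_subgroup a E `<=` scale_subgroup a F.
Proof.
move=> EF; apply: scale_subgroup_sub; first exact: scale_subgroup_is_subgroup.
by move=> g x /EF; exact: scale_subgroup_gen.
Qed.

(** If [g] moves [x] within [E], then [h * g * h^-1] moves [a h x] within [E] by invariance, so
    conjugation sends generators to generators. *)
Lemma scale_subgroup_conj E g h : act_invariant E ->
  scale_subgroup a E g -> scale_subgroup a E (h * g * h^-1).
Proof.
move=> invE; pose H := [set g | scale_subgroup a E (h * g * h^-1)].
apply: (@scale_subgroup_sub E H) => [|{}g x /(invE h) Ehx].
  have [N1 NV] := scale_subgroup_is_subgroup E.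
  split=> [|g1 g2 Ng1 Ng2]; first by rewrite /H/= mulg1 mulgV.
  by have := NV _ _ Ng1 Ng2; rewrite /H/= !invgM invgK !mulgA mulgVK.
by apply: (@scale_subgroup_gen _ _ (a h x)); rewrite !actM actK.
Qed.

Definition scale_normal_subgroup E (invE : act_invariant E) :=
  NormalSubgroup (scale_subgroup_is_subgroup E)
    (fun g h => @scale_subgroup_conj E g h invE).

End scale_subgroup_theory.

(** * Inverse sequences of surjective homomorphisms *)

Section surjective_sequence.
Context (G : nat -> groupType).
Context (psi : forall i, UMagmaMorphism.type (G i.+1) (G i)).
Context (psi_surj : forall i y, exists x, psi i x = y).

Lemma surjective_mittag_leffler : mittag_leffler psi.
Proof.
have bondT n q : range (bond (fun i => psi i) n q) = setT.
  elim: q => [|q IHq]; first by rewrite -subTset => x _; exists x.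
  rewrite -subTset => x _.
  have [y _ <-] : range (bond (fun i => psi i) n q) x by rewrite IHq.
  by have [z <-] := psi_surj y; exists z.
by move=> n; exists 0 => q _; rewrite !bondT.
Qed.

(** The equation at [i] amounts to [psi i (g i.+1) = (h i)^-1 * g i], which sections of the bonding
    maps solve recursively from [g 0 = 1]. *)
Lemma surjective_trivial_lim1 : trivial_lim1 psi.
Proof.
move=> h.
have [s sP] : exists s : forall i, G i -> G i.+1,
    forall i, cancel (s i) (psi i).
  exists (fun i y => sval (cid (psi_surj y))) => i y.
  exact: svalP (cid (psi_surj y)).
pose fix g i : G i :=
  if i is i'.+1 return G i then s i' ((h i')^-1 * g i') else 1.
exists g; apply/functional_extensionality_dep => i.
by rewrite /lim1_map /= sP invgM invgK mulgA mulgV mul1g.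
Qed.

End surjective_sequence.

(** * Entourages of an inverse limit *)

Section invlim_uniformity.
Context (X : nat -> uniformType) (phi : forall i, X i.+1 -> X i).

Lemma entourage_invlim n (D : set (X n * X n)) : entourage D ->
  entourage [set xy : invlim_space phi * invlim_space phi |
             D (val xy.1 n, val xy.2 n)].
Proof.
move=> entD.
exists [set xy : prod_topology X * prod_topology X | D (xy.1 n, xy.2 n)] => //.
(* The product uniformity is the filter generated by the entourages pulled back along single
   projections, and the set at hand is one of these. *)
rewrite /entourage /= /sup_ent smallest_filter_finI.
apply: sub_gen_smallest.
have entP : `[< @entourage (initial_topology (@proj _ X n))
    [set xy | D (xy.1 n, xy.2 n)] >].
  by apply/asboolP; exists D.
by exists (exist _ (n, [set xy | D (xy.1 n, xy.2 n)]) entP).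
Qed.

(** Uniform continuity of the bonding maps lets a condition on an early coordinate be imposed on a
    later one, so finitely many conditions merge into one on a single coordinate. *)
Lemma invlim_entourageP E : (forall i, unif_continuous (@phi i)) ->
  @entourage (invlim_space phi) E ->
  exists n, exists2 D, @entourage (X n) D &
    forall x y : invlim_space phi, D (val x n, val y n) -> E (x, y).
Proof.
move=> phi_uc.
have pullback n k D : @entourage (X n) D ->
    exists2 D', @entourage (X (k + n)) D' & forall x y : invlim_space phi,
      D' (val x (k + n), val y (k + n)) -> D (val x n, val y n).
  move=> entD; elim: k => [|k [D' entD' D'D]]; first by exists D.
  exists [set xy | D' (@phi (k + n) xy.1, @phi (k + n) xy.2)].
    exact: phi_uc.
  by move=> x y /=; rewrite (set_valP x (k + n)) (set_valP y (k + n)); exact: D'D.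
(* [P] is a filter containing the generators of the product uniformity, hence all its entourages. *)
pose P := [set V : set (prod_topology X * prod_topology X) |
  exists n, exists2 D, @entourage (X n) D &
    forall x y : invlim_space phi, D (val x n, val y n) -> V (val x, val y)].
suff entP : entourage `<=` P.
  move=> [V /entP[n [D entD DV]] VE]; exists n, D => // x y /DV Vxy; exact: VE.
rewrite /entourage /= /sup_ent smallest_filter_finI; apply: smallest_sub.
  split.
  - by exists 0, setT => //; exact: filterT.
  - move=> V W [n [D entD DV]] [m [D' entD' DW]].
    have [D1 entD1 D1D] := pullback n m _ entD.
    have [D2 entD2 D2D] := pullback m n _ entD'.
    (* Both pulled-back entourages now live on the same coordinate [n + m]. *)
    rewrite addnC in D1 entD1 D1D.
    exists (n + m), (D1 `&` D2); first exact: filterI.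
    by move=> x y [/D1D/DV Vxy /D2D/DW Wxy].
  - move=> V W VW [n [D entD DV]]; exists n, D => // x y /DV; exact: VW.
move=> _ [[[n V] /= entV] _ <-] /=.
move: entV => /asboolP[D entD DV]; exists n, D => // x y Dxy.
exact: (DV (val x, val y)).
Qed.

End invlim_uniformity.

(** * Metrizable uniformities *)

Section metrizable_theory.
Import Order.TTheory GRing.Theory Num.Theory.
Context (R : realType) (X : uniformType) (X_metrizable : metrizable R X).

Lemma metrizable_separated (x y : X) :
  (forall E, entourage E -> E (x, y)) -> x = y.
Proof.
have [d [d0 dsym dtri ->]] := X_metrizable.
move=> xy; apply/d0/eqP; rewrite eq_le; apply/andP; split.
  apply/ler_addgt0Pl => e e0; rewrite addr0; apply/ltW.
  by apply: (xy [set xy | (d xy.1 xy.2 < e)%R]); exists e.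
(* Nonnegativity of [d] comes from symmetry and the triangle inequality:
   [0 = d x x <= 2 * d x y]. *)
have : (d x x <= d x y + d y x)%R by exact: dtri.
by rewrite (d0 x x).2// (dsym y x) -mulr2n pmulrn_lge0.
Qed.

Lemma metrizable_countable_base : exists2 B : nat -> set (X * X),
  (forall i, entourage (B i)) & forall E, entourage E -> exists i, B i `<=` E.
Proof.
have [d [_ _ _ ->]] := X_metrizable.
exists (fun i => [set xy | (d xy.1 xy.2 < i.+1%:R^-1)%R]) => [i|E [e e0 eE]].
  by exists (i.+1%:R^-1)%R => //=; rewrite invr_gt0.
exists (Num.truncn e^-1%R) => xy xyi; apply: eE; apply: lt_trans xyi _.
by rewrite invf_plt ?posrE// truncnS_gt.
Qed.

End metrizable_theory.

(** * Filtrations by scale, and Cauchy sequences in an orbit *)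

Section scale_filtration.
Context (G : groupType) (X : uniformType) (a : group_action G X).

(** A single index controls both the size of [E i] and the displacement by its scale subgroup, so
    the two estimates can be chained. *)
Definition scale_filtration (E : nat -> set (X * X)) :=
  [/\ forall i, entourage (E i), forall i, act_invariant a (E i),
      forall i, E i.+1 `<=` E i &
      forall D, entourage D -> exists2 i, E i `<=` D &
        forall g x, scale_subgroup a (E i) g -> D (x, a g x)].

Lemma scale_filtration_exists (R : realType) :
  metrizable R X -> uniformly_equicontinuous a ->
  small_scale_bounded_orbits a -> exists E, scale_filtration E.
Proof.
move=> /metrizable_countable_base[B entB baseB] equicont bounded.
have /choice[F FP] i : exists F, [/\ entourage F, act_invariant a F, F `<=` B i &
    forall g x, scale_subgroup a F g -> B i (x, a g x)].
  have [F entF FB] := bounded _ (entB i).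
  have [F' [entF' invF' F'sub]] :=
    invariant_entourage equicont (filterI entF (entB i)).
  exists F'; split=> // [xy /F'sub[]//|g x Ng]; apply: (FB x); split=> /=.
    by exists 1; [exact: (scale_subgroup_is_subgroup a F).1|rewrite act1].
  exists g => //; apply: scale_subgroupS Ng => xy /F'sub[]//.
(* Finite intersections make the sequence decreasing; the bounds on orbits persist because scale
   subgroups are monotone in the entourage. *)
pose fix E i := if i is i'.+1 then E i' `&` F i else F 0.
have EF i : E i `<=` F i by case: i => [//|i] xy [].
exists E; split.
- by elim=> [|i IHi]; [case: (FP 0)|apply: filterI => //; case: (FP i.+1)].
- elim=> [|i IHi]; first by case: (FP 0).
  move=> g x y [Exy Fxy]; split; first exact: IHi.
  by have [_ invF _ _] := FP i.+1; exact: invF.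
- by move=> i xy [].
move=> D /baseB[i BD]; have [_ _ FB NB] := FP i; exists i.
  by move=> xy /EF/FB/BD.
by move=> g x Ng; apply/BD/NB; apply: scale_subgroupS Ng; exact: EF.
Qed.

(** The sequence is Cauchy in one fiber of the projection; its limit there lies in the orbit of
    [u 0], hence has the form [a g (u 0)]. *)
Lemma orbit_sequence_cvg (u : nat -> X) :
  complete_fibers (orbit_proj a) ->
  (forall i, exists g, u i = a g (u 0)) ->
  (forall D, entourage D ->
    exists i, forall j k, i <= j -> i <= k -> D (u j, u k)) ->
  exists g, forall D, entourage D ->
    exists i, forall j, i <= j -> D (a g (u 0), u j).
Proof.
move=> complete u_orbit u_cauchy.
pose z := orbit_proj a (u 0).
have uz i : (orbit_proj a @^-1` [set z]) (u i).
  have [g ug] := u_orbit i; apply/val_inj/seteqP; split=> _ [h _ <-] /=.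
    by exists (h * g) => //; rewrite ug actM.
  by exists (h * g^-1) => //; rewrite ug actM actK.
pose v i : set_type (orbit_proj a @^-1` [set z]) := SigSub (mem_set (uz i)).
have [|l ul] := complete z (v @ \oo) _.
  move=> A [E entE EA]; have [i iE] := u_cauchy _ entE.
  exists (v @` [set j | i <= j], v @` [set j | i <= j]).
    by split; exists i => // j /= ij; exists j.
  move=> [p q] /= [[j ij jp] [k ik kq]]; apply: EA => /=.
  by rewrite -jp -kq; exact: iE.
have lz : orbit_proj a (val l) = z := set_valP l.
have [g _ gu] : orbit_of a (u 0) (val l).
  have <- : orbit_of a (val l) = orbit_of a (u 0) := congr1 val lz.
  by exists 1 => //; exact: act1.
exists g => D entD; have/cvg_entourageP := ul.
move=> /(_ [set xy | D (val xy.1, val xy.2)])[|i _ iD].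
  by exists D.
by exists i => j ij; rewrite gu; exact: iD.
Qed.

End scale_filtration.

(** * From (1) to (2): the limit of the quotients by scale subgroups *)

Section filtration_to_invlim.
Context (G : groupType) (X : uniformType) (a : group_action G X).
Context (a_faithful : faithful a) (equicont : uniformly_equicontinuous a).
Context (sepX : forall x y : X, (forall D, entourage D -> D (x, y)) -> x = y).
Context (complete : complete_fibers (orbit_proj a)).
Context (E : nat -> set (X * X)) (filtE : scale_filtration a E).

Let entE : forall i, entourage (E i). Proof. by case: filtE. Qed.
Let invE : forall i, act_invariant a (E i). Proof. by case: filtE. Qed.
Let decrE : forall i, E i.+1 `<=` E i. Proof. by case: filtE. Qed.
Let baseE : forall D, entourage D -> exists2 i, E i `<=` D &
  forall g x, scale_subgroup a (E i) g -> D (x, a g x).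
Proof. by case: filtE. Qed.

Let N i : normal_subgroup G := scale_normal_subgroup (@invE i).
Let subN i : is_subgroup (N i) := normal_is_subgroup (N i).
Let decrN i : N i.+1 `<=` N i := scale_subgroupS (@decrE i).

Let G_ i : groupType := quotient_group (N i).
Let psi i : UMagmaMorphism.type (G_ i.+1) (G_ i) := coset_coarsening (@decrN i).
Let X_ i : uniformType := quotient_space (N i) equicont.
Let phi i : X_ i.+1 -> X_ i := @orbit_coarsen _ _ _ equicont (N i.+1) (N i).
Let a_ i : group_action (G_ i) (X_ i) := quotient_action equicont (N i).

Let compat : compatible_actions psi phi a_.
Proof. by move=> i g x; exact: coarsen_compatible. Qed.

(** This is where completeness enters, for groups and spaces alike. The sequence is Cauchy because
    orbits of [N i] shrink, and its limit stays in the [N i]-orbit of [u i] because two [E i]-close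
    points of one [G]-orbit differ by a generator of [N i]. *)
Lemma scale_sequence_limit (u : nat -> X) :
  (forall i j, i <= j -> exists2 n, N i n & a n (u i) = u j) ->
  exists g, forall i, exists2 n, N i n & a n (u i) = a g (u 0).
Proof.
move=> uN.
have [|D /baseE[i _ DN]|g gu] := orbit_sequence_cvg complete (u := u).
- by move=> i; have [n _ <-] := uN 0 i (leq0n i); exists n.
- exists i => j k ij ik; have [n Nn <-] := uN i j ij.
  have [m Nm <-] := uN i k ik.
  have -> : a m (u i) = a (m * n^-1) (a n (u i)) by rewrite actM actK.
  by apply: DN; exact: (subN i).2.
exists g => i; have [j guj] := gu _ (entE i).
have [n Nn nu] := uN i (maxn i j) (leq_maxl i j).
have [h _ hu] := uN 0 (maxn i j) (leq0n _).
have := guj _ (leq_maxr i j).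
(* The term [u (maxn i j)] is [E i]-close to the limit and is its translate by [h * g^-1], which is
   therefore a generator of [N i]. *)
have -> : u (maxn i j) = a (h * g^-1) (a g (u 0)) by rewrite actM actK.
move=> /scale_subgroup_gen Nhg; exists ((h * g^-1)^-1 * n).
  by apply: (subgroupM (subN i)) => //; exact: (subgroupV (subN i)).
by rewrite actM nu -hu -actM invgM invgK mulgVK.
Qed.

(** This passes from points back to cosets: elements of [G] that agree at one point are congruent
    modulo every [N i]. *)
Lemma scale_stabilizer i g x : a g x = x -> N i g.
Proof.
move=> gx; apply: (@scale_subgroup_gen _ _ a _ _ x).
by rewrite gx; exact: entourage_refl.
Qed.

Lemma scale_intersection g : (forall i, N i g) -> forall x, a g x = x.
Proof. by move=> Ng x; apply/esym/sepX => D /baseE[i _]; apply; exact: Ng. Qed.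

Definition to_invlim_group (g : G) : invlim_group psi :=
  SigSub (mem_set ((fun i => coset_coarsenE (@decrN i) g) :
    threads (fun i => psi i) (fun i => coset (N i) g))).

Lemma to_invlim_group_morph : monoid_morphism to_invlim_group.
Proof.
split=> [|g h]; apply/val_inj/functional_extensionality_dep => i //=.
exact: cosetM.
Qed.

HB.instance Definition _ := isUMagmaMorphism.Build G (invlim_group psi)
  to_invlim_group to_invlim_group_morph.

Definition to_invlim_space (x : X) : invlim_space phi :=
  SigSub (mem_set ((fun i => orbit_coarsenE equicont (@decrN i) x) :
    threads phi (fun i => orbit_class equicont (N i) x))).

(** Representatives of later coordinates also represent the earlier ones, so consecutive choices
    differ by elements of [N i], as [scale_sequence_limit] requires. *)
Lemma invlim_group_lift (q : invlim_group psi) i j :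
  i <= j -> coset (N i) (repr (val q j)) = val q i.
Proof.
move=> /subnK <-; move: (j - i) => d {j}; elim: d i => [|d IHd] i.
  exact: coset_repr.
rewrite addSnnS -(set_valP q i) -(IHd i.+1).
by rewrite [RHS](coset_coarsenE (@decrN i)).
Qed.

Lemma invlim_space_lift (q : invlim_space phi) i j :
  i <= j -> orbit_class equicont (N i) (repr (val q j)) = val q i.
Proof.
move=> /subnK <-; move: (j - i) => d {j}; elim: d i => [|d IHd] i.
  exact: orbit_repr.
rewrite addSnnS -(set_valP q i) -(IHd i.+1).
by rewrite [RHS](orbit_coarsenE equicont (@decrN i)).
Qed.

Lemma to_invlim_group_bij : bijective to_invlim_group.
Proof.
rewrite -setTT_bijective; split=> //.
  move=> g h _ _ gh; have Ngh i : N i (g * h^-1).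
    by apply/coset_eq; have := congr1 (fun f => val f i) gh.
  have /a_faithful := scale_intersection Ngh.
  by move=> /(congr1 (fun k => k * h)); rewrite mulgVK mul1g.
move=> q _ /=.
(* If [X] is empty, faithfulness makes [G] trivial. Otherwise a base point [x] turns the lifts of
   the thread into a sequence of points. *)
have [[x _]|X0] := pselect (exists x : X, True); last first.
  exists 1 => //; apply/val_inj/functional_extensionality_dep => i /=.
  rewrite -(coset_repr (val q i)); congr coset; apply/esym/a_faithful => x.
  by case: X0; exists x.
pose g i : G := repr (val q i).
have [i j ij|h hg] := @scale_sequence_limit (fun i => a (g i) x).
  exists (g j * (g i)^-1); last by rewrite -actM mulgVK.
  by apply/coset_eq; rewrite invlim_group_lift// coset_repr.
exists (h * g 0) => //; apply/val_inj/functional_extensionality_dep => i /=.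
rewrite -(coset_repr (val q i)); apply/coset_eq.
have [n Nn nh] := hg i.
(* Both [h * g 0] and [n * g i] send [x] to the same point, so they differ by an element of its
   stabilizer. *)
have Ns : N i ((h * g 0)^-1 * (n * g i)).
  by apply: (@scale_stabilizer _ _ x); rewrite !actM nh -(actM a h) actK.
have := subgroupM (subN i) Nn (normal_conj (g i) (subgroupV (subN i) Ns)).
by rewrite !invgM !invgK !mulgA mulgK mulgV mul1g.
Qed.

Lemma to_invlim_space_bij : bijective to_invlim_space.
Proof.
rewrite -setTT_bijective; split=> //.
  move=> x y _ _ xy; apply: sepX => D /baseE[i _ DN].
  have /orbit_eq[n Nn <-] :
    orbit_class equicont (N i) x = orbit_class equicont (N i) y.
    exact: (congr1 (fun f => val f i) xy).
  exact: DN.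
move=> q _ /=.
have [i j ij|h hu] := @scale_sequence_limit (fun i => repr (val q i)).
  by apply/orbit_eq; rewrite !invlim_space_lift.
exists (a h (repr (val q 0))) => //.
apply/val_inj/functional_extensionality_dep => i /=.
rewrite -(orbit_repr (val q i)); apply/esym/orbit_eq; exact: hu.
Qed.

Let phi_unif_continuous i : unif_continuous (@phi i).
Proof. exact: orbit_coarsen_unif_continuous. Qed.

Lemma to_invlim_space_equivalence : uniform_equivalence to_invlim_space.
Proof.
have [f' fK f'K] := to_invlim_space_bij; exists f'; split=> //.
  move=> D /(invlim_entourageP phi_unif_continuous)[n [D' entD' D'D]].
  apply: (@filterS _ entourage _ _ _ _
    (@orbit_unif_continuous _ _ _ equicont (N n) _ entD')) => -[x y] /= D'xy.
  exact: D'D.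
(* The two splittings of [D] serve a path of three steps: along an [N i]-orbit to [u], across [E i]
   to [v], and along an [N i]-orbit again. *)
move=> D entD; have ent1 := entourage_split_ent entD.
have [i E2 N2] := baseE (entourage_split_ent ent1).
have := entourage_invlim phi (entourage_orbit equicont (N i) (entE i)).
apply: filterS => -[p r] /= [[u v] Euv].
rewrite -{1}(f'K p) -{1}(f'K r).
move=> -[] /esym/orbit_eq[n Nn xu] /orbit_eq[m Nm vy].
apply: (entourage_split u entD).
  by apply: split_ent_subset => //; rewrite -xu; exact: N2.
apply: (entourage_split v ent1); first exact: E2.
by rewrite -vy; exact: N2.
Qed.

Lemma filtration_invlim :
  exists (G_ : nat -> groupType)
    (psi : forall i, UMagmaMorphism.type (G_ i.+1) (G_ i))
    (X_ : nat -> uniformType) (phi : forall i, X_ i.+1 -> X_ i)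
    (a_ : forall i, group_action (G_ i) (X_ i))
    (compat : compatible_actions psi phi a_),
    [/\ mittag_leffler psi /\ trivial_lim1 psi,
        forall i, unif_continuous (phi i),
        forall i, uniformly_properly_discontinuous (a_ i),
        forall i, neutral (a_ i) &
        exists (theta : UMagmaMorphism.type G (invlim_group psi))
          (Phi : X -> invlim_space phi),
          [/\ bijective theta, uniform_equivalence Phi &
              forall g x,
                Phi (a g x) = invlim_action compat (theta g) (Phi x)]].
Proof.
have psi_surj i y : exists x, psi i x = y.
  exists (coset (N i.+1) (repr y)); rewrite -[RHS]coset_repr.
  exact: (coset_coarsenE (@decrN i)).
exists G_, psi, X_, phi, a_, compat; split=> [|||i|].
- split; [exact: surjective_mittag_leffler|exact: surjective_trivial_lim1].
- exact: phi_unif_continuous.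
- move=> i; apply: (quotient_action_upd equicont (entE i)) => g x.
  exact: scale_subgroup_gen.
- exact: quotient_action_neutral.
exists to_invlim_group, to_invlim_space; split.
- exact: to_invlim_group_bij.
- exact: to_invlim_space_equivalence.
move=> g x; apply/val_inj/functional_extensionality_dep => i /=.
by rewrite [RHS]quotient_actE.
Qed.

End filtration_to_invlim.

(** * From (2) to (1): coordinates of orbits and of Cauchy filters *)

Section invlim_to_conditions.
Context (G : groupType) (X : uniformType) (a : group_action G X).
Context (G_ : nat -> groupType)
  (psi : forall i, UMagmaMorphism.type (G_ i.+1) (G_ i))
  (X_ : nat -> uniformType) (phi : forall i, X_ i.+1 -> X_ i)
  (a_ : forall i, group_action (G_ i) (X_ i))
  (compat : compatible_actions psi phi a_).
Context (phi_uc : forall i, unif_continuous (@phi i))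
  (a_upd : forall i, uniformly_properly_discontinuous (a_ i)).
Context (theta : UMagmaMorphism.type G (invlim_group psi))
  (Phi : X -> invlim_space phi).
Context (theta_bij : bijective theta) (Phi_equiv : uniform_equivalence Phi).
Context (Phi_act : forall g x,
  Phi (a g x) = invlim_action compat (theta g) (Phi x)).

Lemma upd_free i g x : a_ i g x = x -> g = 1.
Proof.
have [E0 entE0 E0P] := a_upd i.
by move=> gx; apply: E0P; exists x; rewrite gx; exact: entourage_refl.
Qed.

Lemma invlim_coordinate_act i g x :
  val (Phi (a g x)) i = a_ i (val (theta g) i) (val (Phi x) i).
Proof. by rewrite Phi_act. Qed.

Lemma entourage_coordinate n D : @entourage (X_ n) D ->
  entourage [set xy : X * X | D (val (Phi xy.1) n, val (Phi xy.2) n)].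
Proof.
have [f' [_ _ Phi_uc _]] := Phi_equiv.
by move=> entD; exact: (Phi_uc _ (entourage_invlim phi entD)).
Qed.

(** Equality of one coordinate is the form used below, since proper discontinuity makes coordinates
    constant on scale orbits and eventually constant along Cauchy filters in an orbit. *)
Lemma entourage_coordinateP E : @entourage X E ->
  exists n, forall x y, val (Phi x) n = val (Phi y) n -> E (x, y).
Proof.
have [f' [PhiK _ _ f'_uc]] := Phi_equiv.
move=> /f'_uc/(invlim_entourageP phi_uc)[n [D entD DE]]; exists n => x y xy.
have := DE (Phi x) (Phi y); rewrite /= !PhiK; apply.
by rewrite xy; exact: entourage_refl.
Qed.

Lemma invlim_small_scale_bounded_orbits : small_scale_bounded_orbits a.
Proof.
move=> E /entourage_coordinateP[n nE].
have [E0 entE0 E0P] := a_upd n.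
exists [set xy | E0 (val (Phi xy.1) n, val (Phi xy.2) n)].
  exact: entourage_coordinate.
(* Elements with trivial [n]-th coordinate form a subgroup, so it suffices to check the generators,
   where [E0] applies. *)
have subker g : scale_subgroup a
    [set xy | E0 (val (Phi xy.1) n, val (Phi xy.2) n)] g -> val (theta g) n = 1.
  move: g; apply: scale_subgroup_sub => [|g x Exgx].
    split=> [|g h g1 h1]; first by rewrite gmulf1.
    have -> : val (theta (g * h^-1)) n = val (theta g) n * (val (theta h) n)^-1.
      by rewrite gmulfM gmulfV.
    by rewrite g1 h1 mulgV.
  by apply: E0P; exists (val (Phi x) n); rewrite -invlim_coordinate_act.
move=> x [_ _] [/= [g /subker g1 <-] [h /subker h1 <-]]; apply: nE.
by rewrite !invlim_coordinate_act g1 h1.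
Qed.

Lemma invlim_complete_fibers : complete_fibers (orbit_proj a).
Proof.
move=> z F FF Fcauchy.
have [x0 z0] : exists x0, orbit_proj a x0 = z.
  by have [x0 _ x0z] := set_valP z; exists x0; exact: val_inj.
have orbitP (y : set_type (orbit_proj a @^-1` [set z])) :
    exists g, val y = a g x0.
  have yz : orbit_proj a (val y) = z := set_valP y.
  have [g _ gy] : orbit_of a x0 (val y).
    have <- : orbit_of a (val y) = orbit_of a x0.
      apply: (congr1 val (_ : orbit_proj a (val y) = orbit_proj a x0)).
      by rewrite yz.
    by exists 1 => //; exact: act1.
  by exists g.
have Fcoord n : exists g, F [set y |
    val (Phi (val y)) n = a_ n g (val (Phi x0) n)].
  have [E0 entE0 E0P] := a_upd n.
  have [|[A B] [/= FA FB] ABE0] := Fcauchy [set yy' |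
    E0 (val (Phi (val yy'.1)) n, val (Phi (val yy'.2)) n)].
    by exists [set xy | E0 (val (Phi xy.1) n, val (Phi xy.2) n)] => //;
      exact: entourage_coordinate.
  have [y Ay] := filter_ex FA; have [g yg] := orbitP y.
  exists (val (theta g) n); apply: filterS FB => y' By'.
  have [g' yg'] := orbitP y'.
  have := ABE0 (y, y') (conj Ay By').
  rewrite /= yg yg' !invlim_coordinate_act => E0gg'.
  set h := val (theta g) n in E0gg' *; set h' := val (theta g') n in E0gg' *.
  (* The element [h' * h^-1] carries one of two [E0]-close points to the other, so it is trivial and
     [h' = h]. *)
  have /(congr1 (fun k => k * h)) : h' * h^-1 = 1.
    apply: E0P; exists (a_ n h (val (Phi x0) n)).
    by rewrite -(actM (a_ n)) mulgVK.
  by rewrite mulgVK mul1g => ->.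
pose gamma n := sval (cid (Fcoord n)).
have Fgamma n :
    F [set y | val (Phi (val y)) n = a_ n (gamma n) (val (Phi x0) n)].
  exact: svalP (cid (Fcoord n)).
(* The [gamma n] are chosen separately for each [n]. A point [y] in two consecutive filter sets
   shows that [psi n (gamma n.+1)] and [gamma n] agree at the coordinate of [x0], and freeness makes
   them equal. *)
have gamma_thread : threads (fun i => psi i) gamma.
  move=> n; have [y [yn yn1]] := filter_ex (filterI (Fgamma n) (Fgamma n.+1)).
  have : a_ n (psi n (gamma n.+1)) (val (Phi x0) n) =
         a_ n (gamma n) (val (Phi x0) n).
    by rewrite -yn -(set_valP (Phi (val y)) n) yn1 compat (set_valP (Phi x0) n).
  move=> /(congr1 (a_ n (gamma n)^-1)); rewrite actK -actM => /upd_free.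
  by move=> /(congr1 (fun k => gamma n * k)); rewrite mulgA mulgV mul1g mulg1.
have [theta' _ theta'K] := theta_bij.
pose g := theta' (SigSub (mem_set gamma_thread)).
have gz : (orbit_proj a @^-1` [set z]) (a g x0).
  rewrite /= -z0; apply/val_inj/seteqP; split=> _ [h _ <-] /=.
    by exists (h * g) => //; rewrite actM.
  by exists (h * g^-1) => //; rewrite actM actK.
(* The limit [a g x0] shares its [n]-th coordinate with every point of the filter set given by
   [Fgamma n]. *)
exists (SigSub (mem_set gz)); apply/cvg_entourageP => A [E entE EA].
have [n nE] := entourage_coordinateP entE.
apply: filterS (Fgamma n) => y yn; apply: EA; apply: nE.
by rewrite yn /= invlim_coordinate_act theta'K.
Qed.

End invlim_to_conditions.

Theorem theorem4p10 (R : realType) (G : groupType) (X : uniformType)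
    (a : group_action G X) (X_metrizable : metrizable R X)
    (a_faithful : faithful a) (a_equicontinuous : uniformly_equicontinuous a) :
  (small_scale_bounded_orbits a /\ complete_fibers (orbit_proj a))
  <->
  exists (G_ : nat -> groupType)
    (psi : forall i, UMagmaMorphism.type (G_ i.+1) (G_ i))
    (X_ : nat -> uniformType) (phi : forall i, X_ i.+1 -> X_ i)
    (a_ : forall i, group_action (G_ i) (X_ i))
    (compat : compatible_actions psi phi a_),
    [/\ mittag_leffler psi /\ trivial_lim1 psi,
        forall i, unif_continuous (phi i),
        forall i, uniformly_properly_discontinuous (a_ i),
        forall i, neutral (a_ i) &
        exists (theta : UMagmaMorphism.type G (invlim_group psi))
          (Phi : X -> invlim_space phi),
          [/\ bijective theta, uniform_equivalence Phi &
              forall g x,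
                Phi (a g x) = invlim_action compat (theta g) (Phi x)]].
Proof.
split=> [[bounded complete]|[G_ [psi [X_ [phi [a_ [compat]]]]]]].
  have [E filtE] := scale_filtration_exists X_metrizable a_equicontinuous bounded.
  have sepX := metrizable_separated X_metrizable.
  exact: (filtration_invlim a_faithful a_equicontinuous sepX complete filtE).
move=> [_ phi_uc upd _ [theta [Phi [theta_bij Phi_equiv Phi_act]]]]; split.
  exact: (invlim_small_scale_bounded_orbits phi_uc upd Phi_equiv Phi_act).
exact: (invlim_complete_fibers phi_uc upd theta_bij Phi_equiv Phi_act).
Qed.
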